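(* Let $\Gamma$ be a finite group and let $\mathrm{Cay}(\Gamma,S)$ be a normal mixed Cayley graph. Then $\mathrm{Cay}(\Gamma,S)$ is Gaussian integral if and only if it is H-integral.
   Context: $\Gamma$ is a finite group with identity $\mathbf 1$, and $S\subseteq \Gamma$ with $\mathbf 1\notin S$. The mixed Cayley graph $\mathrm{Cay}(\Gamma,S)$ has vertex set $\Gamma$ and edge set $E=\{(a,b): a,b\in\Gamma,\ ba^{-1}\in S\}$ (a set of ordered pairs). It is called normal if $S$ is a union of conjugacy classes of $\Gamma$. The $(0,1)$-adjacency matrix $(a_{uv})_{u,v\in\Gamma}$ has $a_{uv}=1$ if $(u,v)\in E$ and $a_{uv}=0$ otherwise. The graph is Gaussian integral if all eigenvalues of its $(0,1)$-adjacency matrix are Gaussian integers (elements of $\mathbb{Z}[\mathbf i]$, $\mathbf i=\sqrt{-1}$). The Hermitian-adjacency matrix $(h_{uv})_{u,v\in\Gamma}$ has $h_{uv}=1$ if $(u,v)\in E$ and $(v,u)\in E$; $h_{uv}=\mathbf i$ if $(u,v)\in E$ and $(v,u)\notin E$; $h_{uv}=-\mathbf i$ if $(u,v)\notin E$ and $(v,u)\in E$; and $h_{uv}=0$ otherwise. The graph is H-integral if all eigenvalues of its Hermitian-adjacency matrix are integers. *)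

(* Defs.v *)
From HB Require Import structures.
From mathcomp Require Import all_boot all_order all_algebra all_fingroup.
From mathcomp Require Import reals.
From mathcomp Require Import complex.

Set Implicit Arguments.
Unset Strict Implicit.
Unset Printing Implicit Defensive.

Import Order.TTheory GRing.Theory Num.Theory.

Local Open Scope ring_scope.

Section MixedGraphs.

(* A mixed graph on T is a set E of ordered pairs: an undirected edge {a, b}
   is present as both (a, b) and (b, a), an arc only once. *)
Variables (R : realType) (T : finType) (E : {set T * T}).

(* The vertices number the rows and columns through enum_val; the spectrum does
   not depend on this enumeration. *)
Definition adjacency_mx : 'M[R[i]%C]_#|T| :=
  \matrix_(u, v) (if (enum_val u, enum_val v) \in E then 1 else 0).

(* 'i%C is the literal 0 +i* 1, whereas 'i in ring_scope is Num.imaginary. *)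
Definition hermitian_entry (a b : T) : R[i]%C :=
  match (a, b) \in E, (b, a) \in E with
  | true, true => 1
  | true, false => 'i%C
  | false, true => - 'i%C
  | false, false => 0
  end.

Definition hermitian_adjacency_mx : 'M[R[i]%C]_#|T| :=
  \matrix_(u, v) hermitian_entry (enum_val u) (enum_val v).

Definition gaussian_integer (z : R[i]%C) : Prop :=
  exists a b : int, z = a%:~R + b%:~R * 'i%C.

Definition rational_integer (z : R[i]%C) : Prop :=
  exists a : int, z = a%:~R.

Definition gaussian_integral : Prop :=
  forall z : R[i]%C, eigenvalue adjacency_mx z -> gaussian_integer z.

Definition H_integral : Prop :=
  forall z : R[i]%C, eigenvalue hermitian_adjacency_mx z -> rational_integer z.

End MixedGraphs.

Section CayleyGraphs.

Variables (gT : finGroupType) (S : {set gT}).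

Definition Cay : {set gT * gT} :=
  [set ab : gT * gT | (ab.2 * ab.1^-1)%g \in S].

Definition union_of_classes : Prop :=
  exists2 K : {set {set gT}}, K \subset classes [set: gT] & S = cover K.

End CayleyGraphs.

Arguments gaussian_integral R {T} E.
Arguments H_integral R {T} E.

(* Main.v *)
Require Import Defs.
From HB Require Import structures.
From mathcomp Require Import all_boot all_order all_algebra all_fingroup.
From mathcomp Require Import all_solvable all_field all_character.
From mathcomp Require Import reals.
From mathcomp Require Import complex.
From mathcomp Require Import zify ring.

(** Both integrality properties are equivalent to one and the same closure
    property of [S]: whenever [k] is prime to [#|Gamma|] and [k = 1 mod 4],
    an element [x] lies in [S] exactly when [x ^ k] does.

    Write a Cayley matrix as [M_f = (f (v u^-1))_(u, v)], where [f] is a class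
    function with values in Z[i].  The adjacency matrix is [M_f] for [f] the
    indicator function of [S]; the Hermitian matrix is [M_h], where [h x] is
    1, i, -i or 0 according to whether [x] and [x^-1] lie in [S].
    Since [f] is constant on classes, the eigenvalues of [M_f] are the central
    values [(\sum_x f x * chi x) / chi 1], one for each irreducible character
    [chi] ([Cayley_mx_eigenvalueP]).  A field automorphism that fixes i acts on
    all [#|Gamma|]-th roots of unity as a power map z |-> z^k with k = 1 mod 4,
    hence sends [chi x] to [chi (x ^ k)], while it fixes the values of [f].
    - If all central values are Gaussian integers, they are fixed by these
      automorphisms; as irreducible characters span the class functions, this
      forces [f (x ^ k) = f x] ([central_value_power_stable]).
    - Conversely, if [f (x ^ k) = f x] for all these k, then the central values
      are fixed by every automorphism that fixes i, so by Galois theory they lie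
      in Q(i).  They are algebraic integers, and the algebraic integers of Q(i)
      are the Gaussian ones ([power_stable_central_value]).

    So [M_f] has Gaussian spectrum iff [f] is stable under these power maps
    ([Gaussian_spectrum_power_stable]).  Stability of [h] is the same as
    stability of the indicator of [S], because [x \in S] can be read off [h x]
    and conversely [h x] depends only on whether [x] and [x^-1] are in [S].
    Finally [M_h] is Hermitian, so its eigenvalues are real, and a real
    Gaussian integer is an integer.

    Characters have values in the algebraic numbers, whereas the spectra are
    taken in [R[i]].  The two are compared through the characteristic
    polynomial, which has coefficients in Q(i), here [rat[i]]: if all its roots
    in one algebraically closed field come from [rat[i]], then it already splits
    over [rat[i]], with the same roots everywhere ([eigenvalues_transfer]). *)

Set Implicit Arguments.
Unset Strict Implicit.
Unset Printing Implicit Defensive.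

Import Order.TTheory GRing.Theory Num.Theory.

Local Open Scope ring_scope.

(** * Central characters of class functions *)

Section CentralCharacter.

Variables (gT : finGroupType) (G : {group gT}).
Implicit Types (phi : 'CF(G)) (i : Iirr G).

(** The scalar by which the central element [\sum_x phi x * x] of the group
    algebra acts in the irreducible representation affording ['chi_i]. *)
Definition central_value phi i : algC :=
  (\sum_(x in G) phi x * 'chi_i x) / 'chi_i 1%g.

(** Every class function is a combination of the [x |-> 'chi_j x^-1], and the
    generalized orthogonality relation kills all terms but the one with
    [j = i]. *)
Lemma sum_mul_irr_translate phi i y :
  \sum_(x in G) phi x * 'chi_i (x * y)%g = central_value phi i * 'chi_i y.
Proof.
pose a j := ('[phi^*%CF, 'chi_j])^*.
have phiE x : phi x = \sum_j a j * 'chi_j x^-1%g.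
  rewrite -[phi x]conjCK -cfConjCE [in LHS](cfun_sum_cfdot phi^*%CF).
  rewrite sum_cfunE rmorph_sum /=.
  by apply: eq_bigr => j _; rewrite cfunE rmorphM irr_inv.
have key z : \sum_(x in G) phi x * 'chi_i (x * z)%g
   = a i * #|G|%:R * ('chi_i z / 'chi_i 1%g).
  under eq_bigr => x _ do rewrite phiE mulr_suml.
  rewrite exchange_big /=.
  transitivity (\sum_j a j * #|G|%:R * ((i == j)%:R * ('chi_i z / 'chi_i 1%g))).
    apply: eq_bigr => j _; rewrite -generalized_orthogonality_relation.
    rewrite -mulrA mulVKf ?neq0CG // mulr_sumr.
    by apply: eq_bigr => x _; rewrite -mulrA [X in _ * X]mulrC.
  rewrite (bigD1 i) //= eqxx mul1r big1 ?addr0 // => j.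
  by rewrite eq_sym => /negPf->; rewrite mul0r mulr0.
rewrite /central_value; have := key 1%g.
under eq_bigr => x _ do rewrite mulg1.
by move=> ->; rewrite key divff ?irr1_neq0 // mulr1 mulrA mulrAC.
Qed.

(** The sums are, up to [#|G|] and complex conjugation, the coordinates of the
    conjugate of [phi] in the basis of irreducible characters. *)
Lemma irr_sum_eq0 phi :
  (forall i, \sum_(x in G) phi x * 'chi_i x = 0) -> phi = 0.
Proof.
move=> phi0; apply: (can_inj (@cfConjCK _ G)); rewrite raddf0.
rewrite [LHS]cfun_sum_cfdot big1 // => i _; rewrite cfdotE.
under eq_bigr => x _ do rewrite cfConjCE -rmorphM.
by rewrite -rmorph_sum phi0 rmorph0 mulr0 scale0r.
Qed.

(** The sum over each conjugacy class is a value of [phi] times an algebraic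
    integer: this is the integrality of the central characters of class
    sums. *)
Lemma Aint_central_value phi i :
  (forall x, phi x \in Aint) -> central_value phi i \in Aint.
Proof.
move=> Zphi; rewrite /central_value.
rewrite (set_partition_big _ (classes_partition G)) /= mulr_suml.
apply: rpred_sum => C /imsetP[x Gx ->].
rewrite (eq_bigr (fun=> phi x * 'chi_i x)); last first.
  by move=> _ /imsetP[y Gy ->]; rewrite !cfunJ.
rewrite sumr_const -mulrnAr -mulr_natl -mulrA rpredM //.
exact: Aint_class_div_irr1.
Qed.

(** [x] acts by a diagonalizable matrix whose eigenvalues are roots of unity,
    and [x ^ k] by the [k]-th powers of these. *)
Lemma aut_char_pow (nu : {rmorphism algC -> algC}) k (chi : 'CF(G)) x :
    chi \is a character -> x \in G ->
    (forall z, z ^+ #[x]%g = 1 -> nu z = z ^+ k) ->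
  nu (chi x) = chi (x ^+ k)%g.
Proof.
move=> /char_reprP[rG ->] Gx nuE.
have [e [[B uB def_x] [ex1 _] [-> _] _]] := repr_rsim_diag rG Gx.
have def_xk : rG (x ^+ k)%g = invmx B *m diag_mx (\row_j e 0 j ^+ k) *m B.
  elim: k {nuE} => [|k IHk].
    rewrite expg0 repr_mx1; have ->: \row_j e 0 j ^+ 0 = const_mx 1.
      by apply/rowP=> j; rewrite !mxE.
    by rewrite diag_const_mx mulmx1 mulVmx.
  rewrite expgS repr_mxM ?groupX // IHk def_x !mulmxA mulmxK //.
  rewrite -[_ *m diag_mx _ *m diag_mx _]mulmxA mulmx_diag.
  by congr (_ *m diag_mx _ *m _); apply/rowP=> j; rewrite !mxE exprS.
rewrite cfunE groupX // mulr1n def_xk -mulmxA mxtrace_mulC mulmxK //.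
rewrite mxtrace_diag rmorph_sum; apply: eq_bigr => j _.
by rewrite mxE nuE.
Qed.

End CentralCharacter.

(** * Algebraic numbers over the Gaussian field *)

Lemma galois_aut_fixed_Crat (Qn : splittingFieldType rat)
    (QnC : {rmorphism Qn -> algC}) (a : Qn) :
    galois 1 {:Qn} ->
    (forall nu : {rmorphism algC -> algC}, nu (QnC a) = QnC a) ->
  QnC a \in Crat.
Proof.
move=> galQn fix_a; suffices: a \in 1%VS.
  case/vlineP=> r ->; apply/CratP; exists r.
  by rewrite rmorphZ_num rmorph1 mulr1.
rewrite -(galois_fixedField galQn); apply/fixedFieldP; rewrite ?memvf // => s _.
have [nu nuE] := extend_algC_subfield_aut QnC s.
by apply: (fmorph_inj QnC); rewrite nuE fix_a.
Qed.

(** By Galois theory it is enough that every automorphism [nu] fixes the real and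
    the imaginary part of [QnC a].  Complex conjugation may fail to commute with
    [nu]; but if [nu] fixes i then so does its conjugate by complex conjugation,
    and if [nu] sends i to -i then both composites of [nu] with complex
    conjugation fix i.  The hypothesis for these automorphisms tells where [nu]
    sends [QnC a] and its complex conjugate. *)
Lemma aut_fixed_over_i_Crat (Qn : splittingFieldType rat)
    (QnC : {rmorphism Qn -> algC}) (i a : Qn) :
    galois 1 {:Qn} -> QnC i = 'i ->
    (forall nu : {rmorphism algC -> algC}, nu 'i = 'i -> nu (QnC a) = QnC a) ->
  'Re (QnC a) \in Crat /\ 'Im (QnC a) \in Crat.
Proof.
move=> galQn Di fix_a; set x := QnC a.
have [c /(_ a) Dc] :=
  restrict_aut_to_normal_num_field QnC (Num.conj : {rmorphism algC -> algC}).
have fixRI (nu : {rmorphism algC -> algC}) : nu ('Re x) = 'Re x /\ nu ('Im x) = 'Im x.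
  rewrite ReE ImE !fmorph_div !rmorph_nat !(rmorphD, rmorphM, rmorphN) /=.
  have : nu 'i = 'i \/ nu 'i = - 'i.
    by apply/pred2P; rewrite -eqf_sqr -rmorphXn sqrCi rmorphN1.
  case=> nui.
    have nuxc : nu x^* = x^*.
      have := fix_a (Num.conj \o nu \o Num.conj).
      rewrite /= conjCi rmorphN nui rmorphN /= conjCi opprK => /(_ erefl).
      by move/(congr1 Num.conj); rewrite conjCK.
    by rewrite nui (fix_a nu) // nuxc.
  have nux : nu x = x^*.
    have := fix_a (Num.conj \o nu).
    rewrite /= nui rmorphN /= conjCi opprK => /(_ erefl).
    by move/(congr1 Num.conj); rewrite conjCK.
  have nuxc : nu x^* = x.
    have := fix_a (nu \o Num.conj).
    by rewrite /= conjCi rmorphN /= nui opprK => /(_ erefl).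
  by rewrite nui nux nuxc addrC mulNr -mulrN opprB.
have [ReQ ImQ] : exists2 r, 'Re x = QnC r & exists m, 'Im x = QnC m.
  exists ((a + c a) / 2%:R).
    by rewrite ReE fmorph_div rmorphD rmorph_nat /= Dc.
  exists (i * (c a - a) / 2%:R).
  by rewrite ImE fmorph_div rmorphM rmorphB rmorph_nat /= Dc Di.
case=> m Dm; split; [rewrite ImQ | rewrite Dm]; apply: galois_aut_fixed_Crat => // nu.
  by rewrite -ImQ; have [] := fixRI nu.
by rewrite -Dm; have [] := fixRI nu.
Qed.

Lemma i_primitive_root : 4.-primitive_root ('i : algC).
Proof.
have i4 : ('i : algC) ^+ 4 = 1 by rewrite (exprM _ 2 2) sqrCi sqrrN expr1n.
have [m prim_m dv_m4] := prim_order_exists (n := 4) isT i4.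
have : ~~ (m %| 2)%N.
  by rewrite (prim_order_dvd prim_m) sqrCi eq_sym -subr_eq0 opprK (pnatr_eq0 _ 2).
have := dvdn_leq (m := 4) isT dv_m4.
by case: m prim_m dv_m4 => [|[|[|[|[|]]]]].
Qed.

(** The ring of integers of Q(i) is Z[i]. Twice the real part and twice the
    imaginary part are rational algebraic integers, hence integers; the norm is
    an integer too, and modulo 4 this makes both of them even. *)
Lemma Aint_Gaussian (x : algC) :
    x \in Aint -> 'Re x \in Crat -> 'Im x \in Crat ->
  exists a b : int, x = a%:~R + b%:~R * 'i.
Proof.
move=> Zx QRe QIm.
have Zxc : x^* \in Aint by rewrite Aint_aut.
have Zi : 'i \in Aint by exact: Aint_prim_root i_primitive_root.
have /intrP[A DA] : 'Re x *+ 2 \in Num.int.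
  apply: Cint_rat_Aint; first by rewrite rpredMn.
  by rewrite ReE -mulr_natr divfK ?pnatr_eq0 // rpredD.
have /intrP[B DB] : 'Im x *+ 2 \in Num.int.
  apply: Cint_rat_Aint; first by rewrite rpredMn.
  by rewrite ImE -mulr_natr divfK ?pnatr_eq0 // rpredM // rpredB.
have /intrP[N DN] : 'Re x ^+ 2 + 'Im x ^+ 2 \in Num.int.
  apply: Cint_rat_Aint; first by rewrite rpredD // rpredX.
  by rewrite -normC2_Re_Im normCK rpredM.
have eqN : A ^+ 2 + B ^+ 2 = 4 * N.
  apply: (@intr_inj algC); rewrite rmorphM rmorphD !rmorphXn /= -DA -DB -DN.
  ring.
have half (m : int) : exists h, m = h * 2 \/ m = h * 2 + 1.
  by exists (m %/ 2)%Z; lia.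
have [[a DA2] [b DB2]] := (half A, half B).
have {DA2 DB2}[Da Db] : A = a * 2 /\ B = b * 2.
  by move: eqN; rewrite !expr2; case: DA2 => ->; case: DB2 => ->; nia.
exists a, b; rewrite [LHS]Crect; congr (_ + _).
  by apply: (@mulIf _ 2); rewrite ?pnatr_eq0 // mulr_natr DA Da rmorphM.
rewrite mulrC; congr (_ * _).
by apply: (@mulIf _ 2); rewrite ?pnatr_eq0 // mulr_natr DB Db rmorphM.
Qed.

(** * Galois action on central values *)

Definition Gaussian (C : numClosedFieldType) (z : C) : Prop :=
  exists a b : int, z = a%:~R + b%:~R * 'i.

Definition power_stable (gT : finGroupType) (G : {set gT}) (T : Type)
    (f : gT -> T) : Prop :=
  forall k x, coprime #|G| k -> k = 1 %[mod 4] -> x \in G -> f (x ^+ k)%g = f x.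

(** Looking at a primitive root of unity of order [4 n] controls the action on
    [n]-th roots of unity and on i by a single exponent. *)
Lemma aut_i_exponent (nu : {rmorphism algC -> algC}) n :
    (n > 0)%N -> nu 'i = 'i ->
  exists k, [/\ coprime n k, k = 1 %[mod 4]
             & forall z, z ^+ n = 1 -> nu z = z ^+ k].
Proof.
move=> n_gt0 nui; have n4_gt0 : (n * 4 > 0)%N by rewrite muln_gt0 n_gt0.
have [w prim_w] := C_prim_root_exists n4_gt0.
have [k Dk] : exists k : nat, nu w = w ^+ k.
  have [|k Dk] := prim_rootP prim_w (x := nu w); last by exists k.
  by rewrite -rmorphXn (prim_expr_order prim_w) rmorph1.
have nuE z : z ^+ (n * 4) = 1 -> nu z = z ^+ k.
  by case/(prim_rootP prim_w)=> j ->; rewrite rmorphXn /= Dk exprAC.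
have co_k : coprime k (n * 4).
  by rewrite -(prim_root_exp_coprime _ prim_w) -Dk fmorph_primitive_root.
exists k; split.
- by rewrite coprime_sym; move: co_k; rewrite coprimeMr => /andP[].
- have nu_i : 'i = 'i ^+ k :> algC.
    by rewrite -[LHS]nui nuE // mulnC exprM (prim_expr_order i_primitive_root) expr1n.
  by apply/eqP; rewrite -(eq_prim_root_expr i_primitive_root) -nu_i.
by move=> z zn; apply: nuE; rewrite exprM zn expr1n.
Qed.

Lemma reindex_expg (gT : finGroupType) (G : {group gT}) k (F : gT -> algC) :
  coprime #|G| k -> \sum_(x in G) F x = \sum_(x in G) F (x ^+ k)%g.
Proof.
move=> co_k; rewrite (reindex_onto (fun x => x ^+ k)%g (fun x => x ^+ expg_invn G k)%g).
  apply: eq_bigl => x; apply/andP/idP=> [[Gxk /eqP <-] | Gx]; first exact: groupX.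
  by rewrite groupX // expgK.
by move=> x Gx; rewrite expgAC expgK.
Qed.

Lemma aut_Gaussian (nu : {rmorphism algC -> algC}) z :
  nu 'i = 'i -> Gaussian z -> nu z = z.
Proof.
by move=> nui [a [b ->]]; rewrite rmorphD rmorphM /= !rmorph_int nui.
Qed.

Section GaussianValues.

Variables (gT : finGroupType) (G : {group gT}) (phi : 'CF(G)).
Hypothesis Zphi : forall x, Gaussian (phi x).

(** The Galois group of the field of [4 * #|G|]-th roots of unity is used; that
    field contains i and all character values. *)
Lemma power_stable_central_value i :
  power_stable G phi -> Gaussian (central_value phi i).
Proof.
move=> stab.
(* A group of order [4 * #|G|], so that its number field contains i. *)
have cardH : #|setX G [set: 'Z_4]| = (#|G| * 4)%N.
  by rewrite cardsX cardsT card_ord.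
have [Qn galQn [QnC _ [w [prim_w _] QnG]]] :=
  group_num_field_exists (setX_group G [set: 'Z_4]).
rewrite /= cardH in prim_w QnG.
have [j Di] : exists j, QnC j = 'i.
  have prim_Cw : (#|G| * 4).-primitive_root (QnC w) by rewrite fmorph_primitive_root.
  have [|j Dj] := prim_rootP prim_Cw (x := 'i).
    by rewrite mulnC exprM (prim_expr_order i_primitive_root) expr1n.
  by exists (w ^+ j); rewrite rmorphXn.
have /fin_all_exists[chi Dchi] x : exists a, QnC a = 'chi_i x.
  have [Gx | /cfun0->] := boolP (x \in G); last by exists 0; rewrite rmorph0.
  have [|a <-] := QnG _ G _ (irr_char i) x; last by exists a.
  exact: dvdn_mulr _ (order_dvdG Gx).
have /fin_all_exists[f Df] x : exists a, QnC a = phi x.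
  have [a [b ->]] := Zphi x; exists (a%:~R + b%:~R * j).
  by rewrite rmorphD rmorphM /= !rmorph_int Di.
pose v := (\sum_(x in G) f x * chi x) / chi 1%g.
have Dv : QnC v = central_value phi i.
  rewrite fmorph_div rmorph_sum Dchi; congr (_ / _).
  by apply: eq_bigr => x _; rewrite rmorphM /= Df Dchi.
have fix_v (nu : {rmorphism algC -> algC}) : nu 'i = 'i -> nu (QnC v) = QnC v.
  move=> nui; have [k [co_k k1 nuE]] := aut_i_exponent (cardG_gt0 G) nui.
  rewrite Dv fmorph_div rmorph_sum (aut_natr _ (Cnat_irr1 i)); congr (_ / _).
  rewrite [RHS](reindex_expg _ co_k); apply: eq_bigr => x Gx.
  rewrite rmorphM /= (aut_Gaussian nui (Zphi x)) (stab k x) //.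
  rewrite (@aut_char_pow _ _ nu k) ?irr_char // => z zx.
  by apply: nuE; have /dvdnP[q ->] := order_dvdG Gx; rewrite mulnC exprM zx expr1n.
have [QRe QIm] := aut_fixed_over_i_Crat galQn Di fix_v.
rewrite -Dv; apply: Aint_Gaussian => //; rewrite Dv Aint_central_value // => x.
have [a [b ->]] := Zphi x; rewrite rpredD ?rpredM ?Aint_int //.
exact: Aint_prim_root i_primitive_root.
Qed.

(** An automorphism that fixes i and raises [#|G|]-th roots of unity to the
    power [k] sends [\sum_x phi (x ^ k) * chi x] to [\sum_x phi x * chi x], which
    it fixes; being injective, it shows that [phi] and [x |-> phi (x ^ k)] have
    the same products with all characters. *)
Lemma central_value_power_stable :
  (forall i, Gaussian (central_value phi i)) -> power_stable G phi.
Proof.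
move=> Zval k x co_k k1 Gx.
have co_k4 : coprime k (#|G| * 4).
  by rewrite coprimeMr [coprime k #|G|]coprime_sym co_k /= -coprime_modl k1.
have [nu nuE] := Qn_aut_exists co_k4.
have nui : nu 'i = 'i.
  rewrite nuE; last first.
    by rewrite mulnC exprM (prim_expr_order i_primitive_root) expr1n.
  by apply/eqP; rewrite -{2}['i]expr1 (eq_prim_root_expr i_primitive_root) k1.
have nuG z : z ^+ #|G| = 1 -> nu z = z ^+ k.
  by move=> zn; rewrite nuE // exprM zn expr1n.
have psiP : is_class_fun <<G>>%g (finfun (fun x => phi (x ^+ k)%g *+ (x \in G))).
  rewrite genGid; apply: intro_class_fun => [y z Gy Gz | y /negPf->]; rewrite ?mulr0n //.
  by rewrite groupJ ?Gy // -conjXg cfunJ.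
pose psi := Cfun 0 psiP.
have psiE y : y \in G -> psi y = phi (y ^+ k)%g by move=> Gy; rewrite cfunE Gy.
suffices: psi - phi = 0 by move/cfunP/(_ x)/eqP; rewrite !cfunE Gx subr_eq0 => /eqP.
apply: irr_sum_eq0 => i.
transitivity (\sum_(y in G) psi y * 'chi_i y - \sum_(y in G) phi y * 'chi_i y).
  by rewrite -sumrB; apply: eq_bigr => y _; rewrite !cfunE mulrBl.
apply/eqP; rewrite subr_eq0; apply/eqP; apply: (fmorph_inj nu).
have -> : nu (\sum_(y in G) phi y * 'chi_i y) = \sum_(y in G) phi y * 'chi_i y.
  apply: (mulIf (x := ('chi_i 1%g)^-1)); first by rewrite invr_eq0 irr1_neq0.
  rewrite -{1}(aut_natr nu (Cnat_irr1 i)) -fmorphV -rmorphM.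
  exact: aut_Gaussian (Zval i).
rewrite [RHS](reindex_expg _ co_k) rmorph_sum; apply: eq_bigr => y Gy.
rewrite psiE // rmorphM /= (aut_Gaussian nui (Zphi _)).
rewrite (@aut_char_pow _ _ nu k) ?irr_char // => z zy; apply: nuG.
by have /dvdnP[q ->] := order_dvdG Gy; rewrite mulnC exprM zy expr1n.
Qed.

End GaussianValues.

(** * The spectrum of a Cayley matrix *)

Definition Cayley_mx (K : Type) (gT : finGroupType) (f : gT -> K) : 'M[K]_#|gT| :=
  \matrix_(u, v) f (enum_val v * (enum_val u)^-1)%g.

Lemma sum_enum_val (gT : finGroupType) (F : gT -> algC) :
  \sum_(u < #|gT|) F (enum_val u) = \sum_(x in [set: gT]) F x.
Proof.
rewrite [RHS](reindex (@enum_val _ gT)); last exact/onW_bij/enum_val_bij.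
by apply: eq_bigl => u; rewrite inE.
Qed.

Lemma sum_mul_irr_shift (gT : finGroupType) (phi : 'CF([set: gT])) i x y :
  \sum_(v < #|gT|) phi (enum_val v * x^-1)%g * 'chi_i (enum_val v * y)%g
  = central_value phi i * 'chi_i (x * y)%g.
Proof.
rewrite (sum_enum_val (fun v => phi (v * x^-1)%g * 'chi_i (v * y)%g)).
rewrite -sum_mul_irr_translate (reindex_inj (mulIg x)).
by apply: eq_big => [v | v _]; rewrite ?inE // mulgK mulgA.
Qed.

(** The regular character, which vanishes outside 1, is a combination of
    irreducible characters. *)
Lemma irr_translates_separate (gT : finGroupType) (w : 'I_#|gT| -> algC) :
    (forall i y, \sum_u w u * 'chi[[set: gT]]_i (enum_val u * y)%g = 0) ->
  forall u, w u = 0.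
Proof.
move=> w0 u0.
have : \sum_u w u * cfReg [set: gT] (enum_val u * (enum_val u0)^-1)%g = 0.
  under eq_bigr => u _ do rewrite cfReg_sum sum_cfunE mulr_sumr.
  rewrite exchange_big big1 // => i _ /=.
  under eq_bigr => u _ do rewrite cfunE mulrCA.
  by rewrite -mulr_sumr w0 mulr0.
rewrite (bigD1 u0) //= big1 ?addr0 => [|u neq_u].
  rewrite mulgV cfRegE eqxx mulr1n => /eqP.
  by rewrite mulf_eq0 (negPf (neq0CG _)) orbF => /eqP.
by rewrite cfRegE -eq_mulgV1 (inj_eq enum_val_inj) (negPf neq_u) mulr0n mulr0.
Qed.

(** For each irreducible [chi], [u |-> chi u^-1] is a row eigenvector for the
    central value at [chi].  Conversely, pairing an eigenvector with all
    translates [u |-> chi (u y)] multiplies it by [z] and also by the central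
    value at [chi], and one of these pairings is nonzero. *)
Lemma Cayley_mx_eigenvalueP (gT : finGroupType) (phi : 'CF([set: gT])) (z : algC) :
  eigenvalue (Cayley_mx phi) z <-> exists i, z = central_value phi i.
Proof.
split=> [/eigenvalueP[w eq_w nz_w] | [i ->]].
  pose c i (y : gT) := \sum_(u < #|gT|) w 0 u * 'chi[[set: gT]]_i (enum_val u * y)%g.
  have zc i y : z * c i y = central_value phi i * c i y.
    rewrite /c !mulr_sumr.
    transitivity (\sum_(v < #|gT|)
      (\sum_(u < #|gT|) w 0 u * phi (enum_val v * (enum_val u)^-1)%g)
                    * 'chi_i (enum_val v * y)%g).
      apply: eq_bigr => v _; rewrite mulrA; congr (_ * _).
      have /rowP/(_ v) := eq_w; rewrite !mxE => <-.
      by apply: eq_bigr => u _; rewrite mxE.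
    under eq_bigr => v _ do rewrite mulr_suml.
    rewrite exchange_big /=; apply: eq_bigr => u _.
    rewrite mulrCA -sum_mul_irr_shift mulr_sumr.
    by apply: eq_bigr => v _; rewrite mulrA.
  have [i nz_i | all0] := pickP (fun i => [exists y, c i y != 0]).
    have /existsP[y nz_c] := nz_i; exists i.
    exact: (mulIf nz_c).
  case/eqP: nz_w; apply/rowP=> u; rewrite mxE.
  apply: (irr_translates_separate (w := w 0)) => i y.
  by have /existsPn/(_ y)/negbNE/eqP := negbT (all0 i).
apply/eigenvalueP; exists (\row_u 'chi_i (enum_val u)^-1%g).
  apply/rowP=> v; rewrite !mxE.
  under eq_bigr => u _ do rewrite !mxE.
  rewrite (sum_enum_val (fun u => 'chi_i u^-1%g * phi (enum_val v * u^-1)%g)).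
  rewrite -sum_mul_irr_translate.
  rewrite (reindex_inj (h := fun x => x^-1 * enum_val v)%g) => [|x y /mulIg/invg_inj //].
  apply: eq_big => [x | x _]; rewrite ?inE // mulrC invMg invgK.
  rewrite mulKVg -(cfunJ 'chi_i _ (in_setT (enum_val v)^-1)%g).
  by rewrite conjgE invgK !mulgA mulgV mul1g.
apply/eqP=> /rowP/(_ (enum_rank 1%g))/eqP.
by rewrite !mxE enum_rankK invg1 (negPf (irr1_neq0 i)).
Qed.

(** * Comparing spectra in two fields *)

Section RatComplex.

Variable C : numClosedFieldType.

Definition ratiC (q : rat[i]) : C := ratr (complex.Re q) + ratr (complex.Im q) * 'i.

Fact ratiC_is_zmod_morphism : zmod_morphism ratiC.
Proof. by move=> [a b] [c d]; rewrite /ratiC /= !rmorphB /=; ring. Qed.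

Fact ratiC_is_monoid_morphism : monoid_morphism ratiC.
Proof.
split=> [|[a b] [c d]]; first by rewrite /ratiC /= rmorph1 rmorph0 mul0r addr0.
rewrite /ratiC /= rmorphB rmorphD !rmorphM /=.
have := sqrCi C; rewrite expr2 => ii.
transitivity (ratr a * ratr c + ratr b * ratr d * ('i * 'i)
   + (ratr a * ratr d + ratr b * ratr c) * 'i : C); last by ring.
by rewrite ii; ring.
Qed.

HB.instance Definition _ :=
  GRing.isZmodMorphism.Build rat[i] C ratiC ratiC_is_zmod_morphism.
HB.instance Definition _ :=
  GRing.isMonoidMorphism.Build rat[i] C ratiC ratiC_is_monoid_morphism.

End RatComplex.

(** Over [K] the characteristic polynomial of [M] is a product of linear factors
    coming from [F]; since [f] is injective on polynomials, it factors in the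
    same way over [F], and hence over [L]. *)
Lemma eigenvalues_transfer (F : fieldType) (K : closedFieldType) (L : fieldType)
    (f : {rmorphism F -> K}) (g : {rmorphism F -> L}) (P : F -> Prop) n (M : 'M[F]_n) :
    (forall z, eigenvalue (map_mx f M) z -> exists2 q, P q & z = f q) ->
  forall z, eigenvalue (map_mx g M) z -> exists2 q, P q & z = g q.
Proof.
move=> evP z; rewrite eigenvalue_root_char -map_char_poly.
have [r Dp] := closed_field_poly_normal (map_poly f (char_poly M)).
have [s Ps Dr] : exists2 s, (forall q, q \in s -> P q) & r = map f s.
  have: forall x, x \in r -> exists2 q, P q & x = f q.
    move=> x rx; apply: evP; rewrite eigenvalue_root_char -map_char_poly Dp.
    rewrite lead_coef_map (monicP (char_poly_monic M)) rmorph1 scale1r.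
    by rewrite root_prod_XsubC.
  elim: r {Dp} => [|x r IHr] rP; first by exists [::].
  have [s Ps ->] := IHr (fun y ry => rP y (mem_behead (s := x :: r) ry)).
  have [q Pq ->] := rP x (mem_head x r).
  by exists (q :: s) => // q'; rewrite inE => /predU1P[->|/Ps].
have -> : char_poly M = \prod_(q <- s) ('X - q%:P).
  apply: (map_poly_inj f); rewrite Dp lead_coef_map (monicP (char_poly_monic M)).
  rewrite rmorph1 scale1r Dr big_map rmorph_prod /=.
  by apply: eq_bigr => q _; rewrite rmorphB /= map_polyX map_polyC.
rewrite rmorph_prod /= (eq_bigr (fun q => 'X - (g q)%:P)) => [|q _]; last first.
  by rewrite rmorphB /= map_polyX map_polyC.
rewrite -(big_map g xpredT (fun x => 'X - x%:P)) root_prod_XsubC.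
by case/mapP=> q sq ->; exists q; first exact: Ps.
Qed.

Lemma map_Cayley_mx (K L : Type) (gT : finGroupType) (g : K -> L) (f : gT -> K) :
  map_mx g (Cayley_mx f) = Cayley_mx (g \o f).
Proof. by apply/matrixP=> u v; rewrite !mxE. Qed.

Lemma eq_Cayley_mx (K : Type) (gT : finGroupType) (f g : gT -> K) :
  f =1 g -> Cayley_mx f = Cayley_mx g.
Proof. by move=> eq_fg; apply/matrixP=> u v; rewrite !mxE. Qed.

Definition ratGaussian (q : rat[i]) : Prop :=
  exists a b : int, q = (a%:~R +i* b%:~R)%C.

Lemma GaussianP (C : numClosedFieldType) (z : C) :
  Gaussian z <-> exists2 q, ratGaussian q & z = ratiC C q.
Proof.
split=> [[a [b ->]] | [_ [a [b ->]] ->]].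
  by exists (a%:~R +i* b%:~R)%C; [exists a, b | rewrite /ratiC /= !ratr_int].
by exists a, b; rewrite /ratiC /= !ratr_int.
Qed.

Lemma class_fun_cfun (gT : finGroupType) (f : gT -> algC) :
  (forall x y, f (x ^ y)%g = f x) -> exists phi : 'CF([set: gT]), phi =1 f.
Proof.
move=> fJ; have fP : is_class_fun <<[set: gT]>>%g (finfun f).
  by rewrite genGid; apply: intro_class_fun => // x; rewrite inE.
by exists (Cfun 0 fP) => x; rewrite cfunE.
Qed.

(** Through [ratiC] the spectrum over [C] can be replaced by the one over the
    algebraic numbers, which consists of the central values. *)
Lemma Gaussian_spectrum_power_stable (C : numClosedFieldType)
    (gT : finGroupType) (f : gT -> rat[i]) :
    (forall x, ratGaussian (f x)) -> (forall x y, f (x ^ y)%g = f x) ->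
  (forall z, eigenvalue (Cayley_mx (ratiC C \o f)) z -> Gaussian z)
    <-> power_stable [set: gT] f.
Proof.
move=> Zf fJ.
have [|phi Dphi] := @class_fun_cfun gT (ratiC algC \o f).
  by move=> x y /=; rewrite fJ.
have Zphi x : Gaussian (phi x).
  by rewrite Dphi; apply/GaussianP; exists (f x).
have stabP : power_stable [set: gT] phi <-> power_stable [set: gT] f.
  split=> stab k x co_k k1 Gx; have := stab k x co_k k1 Gx; rewrite !Dphi /=.
    exact: fmorph_inj.
  by move=> ->.
have valP : (forall i, Gaussian (central_value phi i)) <-> power_stable [set: gT] phi.
  split; first exact: central_value_power_stable.
  by move=> stab i; apply: power_stable_central_value.
rewrite -stabP -valP -map_Cayley_mx.
split=> [specG i | valG z ev_z]; apply/GaussianP.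
  apply: (eigenvalues_transfer (f := ratiC C) (M := Cayley_mx f)) => [z|].
    by move/specG/GaussianP.
  rewrite map_Cayley_mx -(eq_Cayley_mx Dphi).
  by apply/Cayley_mx_eigenvalueP; exists i.
apply: (eigenvalues_transfer (f := ratiC algC) (M := Cayley_mx f)) ev_z => {}z.
rewrite map_Cayley_mx -(eq_Cayley_mx Dphi) => /Cayley_mx_eigenvalueP[i ->].
exact/GaussianP.
Qed.

Lemma hermitian_eigenvalue_real (C : numClosedFieldType) n (A : 'M[C]_n) z :
  (forall u v, A u v = (A v u)^*) -> eigenvalue A z -> z^* = z.
Proof.
move=> hermA /eigenvalueP[w eq_w nz_w].
pose q := \sum_u w 0 u * (w 0 u)^*.
have q_real : q^* = q.
  by rewrite rmorph_sum; apply: eq_bigr => u _; rewrite rmorphM /= conjCK mulrC.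
have nz_q : q != 0.
  apply: contraNneq nz_w => q0; apply/eqP/rowP=> u; rewrite mxE.
  have /allP/(_ u (mem_index_enum _)) :
      all (fun u => w 0 u * (w 0 u)^* == 0) (index_enum 'I_n).
    have := q0; rewrite /q => /eqP; rewrite psumr_eq0 // => u' _.
    exact: mul_conjC_ge0.
  by rewrite mul_conjC_eq0 => /eqP.
have zq : z * q = \sum_v \sum_u w 0 u * A u v * (w 0 v)^*.
  rewrite mulr_sumr; apply: eq_bigr => v _.
  have /rowP/(_ v) := eq_w; rewrite !mxE mulrA => <-.
  by rewrite mulr_suml.
apply: (mulIf nz_q); rewrite -{1}q_real -rmorphM zq rmorph_sum exchange_big /=.
apply: eq_bigr => v _; rewrite rmorph_sum; apply: eq_bigr => u _.
by rewrite !rmorphM /= conjCK -hermA mulrC [X in _ * X]mulrC mulrA.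
Qed.

(** * Normal mixed Cayley graphs *)

Section NormalCayley.

Variables (gT : finGroupType) (S : {set gT}).

Definition arc_weight (x : gT) : rat[i] := (x \in S)%:R.

Definition hermitian_weight (x : gT) : rat[i] :=
  match x \in S, x^-1%g \in S with
  | true, true => 1
  | true, false => 'i%C
  | false, true => - 'i%C
  | false, false => 0
  end.

Lemma union_of_classesJ x y : union_of_classes S -> ((x ^ y)%g \in S) = (x \in S).
Proof.
case=> K sK ->; have sub u v : u \in cover K -> (u ^ v)%g \in cover K.
  case/bigcupP=> _ /[dup] /(subsetP sK)/imsetP[t _ ->] Kt /class_eqP Dt.
  by apply/bigcupP; exists (t ^: [set: gT])%g; rewrite // -Dt memJ_class ?inE.
by apply/idP/idP=> [xyK | xK]; [rewrite -(conjgK y x) sub | apply: sub].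
Qed.

Lemma adjacency_Cayley_mx (R : realType) :
  adjacency_mx R (Cay S) = Cayley_mx (ratiC R[i] \o arc_weight).
Proof.
apply/matrixP=> u v; rewrite !mxE /= inE /= /arc_weight.
by case: ifP; rewrite ?rmorph1 ?rmorph0.
Qed.

Lemma hermitian_Cayley_mx (R : realType) :
  hermitian_adjacency_mx R (Cay S) = Cayley_mx (ratiC R[i] \o hermitian_weight).
Proof.
apply/matrixP=> u v; rewrite !mxE /= /hermitian_entry /hermitian_weight !inE /=.
rewrite invMg invgK.
have ratiCi : ratiC R[i] 'i%C = 'i%C.
  by rewrite /ratiC /= rmorph0 rmorph1 add0r mul1r.
by do 2!case: (_ \in S); rewrite ?rmorph1 ?rmorph0 ?ratiCi // rmorphN /= ratiCi.
Qed.

(** The sum of the coordinates is 1 at 1 and i, and 0 or -1 at 0 and -i. *)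
Lemma hermitian_weight_mem x :
  (x \in S) = (complex.Re (hermitian_weight x) + complex.Im (hermitian_weight x) == 1).
Proof. by rewrite /hermitian_weight; do 2!case: ifP. Qed.

Lemma power_stable_weights :
  power_stable [set: gT] arc_weight <-> power_stable [set: gT] hermitian_weight.
Proof.
split=> stab k x co_k k1 Gx.
  have stabS y : ((y ^+ k)%g \in S) = (y \in S).
    have /eqP := stab k y co_k k1 (in_setT y).
    by rewrite /arc_weight; do 2!case: (_ \in S).
  by rewrite /hermitian_weight -expgVn !stabS.
by rewrite /arc_weight !hermitian_weight_mem stab.
Qed.

Lemma hermitian_adjacency_mx_sym (R : realType) u v :
  hermitian_adjacency_mx R (Cay S) u v = (hermitian_adjacency_mx R (Cay S) v u)^*.
Proof.
rewrite !mxE /hermitian_entry complexiE.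
by do 2!case: (_ \in Cay S); rewrite ?rmorphN /= ?conjCi ?opprK ?rmorph1 ?rmorph0.
Qed.

End NormalCayley.

Theorem theorem4p13 (R : realType) (gT : finGroupType) (S : {set gT})
    (S_irrefl : (1%g : gT) \notin S) (S_normal : union_of_classes S) :
  gaussian_integral R (Cay S) <-> H_integral R (Cay S).
Proof.
have SJ x y := union_of_classesJ x y S_normal.
have arcP : gaussian_integral R (Cay S) <-> power_stable [set: gT] (arc_weight S).
  rewrite /gaussian_integral adjacency_Cayley_mx.
  apply: Gaussian_spectrum_power_stable => [x | x y].
    by exists (x \in S)%:R, 0; rewrite /arc_weight; case: (x \in S).
  by rewrite /arc_weight SJ.
have hermP := Gaussian_spectrum_power_stable R[i] (f := hermitian_weight S).
rewrite arcP power_stable_weights -hermP -?hermitian_Cayley_mx.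
- split=> [specG z ev_z | specZ z /specZ[a ->]]; last first.
    by exists a, 0; rewrite mul0r addr0.
  have z_real := hermitian_eigenvalue_real (@hermitian_adjacency_mx_sym _ S R) ev_z.
  have [a [b Dz]] := specG z ev_z; exists a; move: z_real.
  rewrite Dz rmorphD rmorphM /= conjCi !rmorph_int mulrN => /addrI/eqP.
  by rewrite eqNr => /eqP->; rewrite addr0.
- move=> x; rewrite /hermitian_weight.
  do 2!case: (_ \in S);
    [exists 1, 0 | exists 0, 1 | exists 0, (-1) | exists 0, 0] => //.
by move=> x y; rewrite /hermitian_weight -conjVg !SJ.
Qed.
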